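(* Let $G_1=(V_1,b_1,m_1)$ and $G_2=(V_2,b_2,m_2)$ be connected, locally finite weighted graphs with fixed vertices $x_1\in V_1$, $x_2\in V_2$, such that $G_1$ has stronger average curvature growth than $G_2$ (with respect to $x_1$, $x_2$). Then $G_1$ has faster volume growth than $G_2$, i.e. $m_1(S_r(x_1))\ge m_2(S_r(x_2))$ for all integers $r\ge 0$.
   Context: A weighted graph $G=(V,b,m)$ consists of a countable set $V$, a measure $m:V\to(0,\infty)$ (with $m(A)=\sum_{x\in A}m(x)$ for $A\subseteq V$), and a symmetric edge weight $b:V\times V\to[0,\infty)$ vanishing on the diagonal. Write $x\sim y$ if $b(x,y)>0$. The graph is locally finite if every vertex has finitely many neighbors, and connected if any two vertices are joined by a path $x_0\sim x_1\sim\dots\sim x_n$; $d(x,y)$ is the smallest number of edges of a path joining $x$ and $y$. For a fixed vertex $x_0$, $S_r(x_0)=\{x\in V: d(x,x_0)=r\}$. The outer and inner curvatures with respect to $x_0$ at $x\in S_r(x_0)$ are $$k_{\pm}(x)=\frac1{m(x)}\sum_{y\in S_{r\pm1}(x_0)}b(x,y),\qquad k_-(x_0)=0.$$ The averaging operator with respect to $x_0$ is $\mathcal{A}f(x)=\frac{1}{m(S_r(x_0))}\sum_{y\in S_r(x_0)}f(y)m(y)$ for $x\in S_r(x_0)$. Let $k^i_\pm$ and $\mathcal{A}_i$ be the curvatures and averaging operator of $G_i$ with respect to $x_i$. One says that $G_1$ has stronger average curvature growth than $G_2$ if (i) $m_1(x_1)=m_2(x_2)$, and (ii) for all $r\ge0$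 and all $x'\in S_r(x_1)$, $x''\in S_r(x_2)$, $$\mathcal{A}_1k^1_+(x')\ge \mathcal{A}_2k^2_+(x'')\quad\text{and}\quad \mathcal{A}_1k^1_-(x')\le\mathcal{A}_2k^2_-(x'').$$ *)

(* Defs.v *)
From HB Require Import structures.
From mathcomp Require Import all_boot all_order all_algebra.
From mathcomp Require Import all_classical all_reals all_analysis.

Set Implicit Arguments.
Unset Strict Implicit.
Unset Printing Implicit Defensive.
Import Order.TTheory GRing.Theory Num.Theory.
Local Open Scope classical_set_scope.
Local Open Scope ring_scope.

Record wgraph (R : realType) := WGraph {
  vertex :> countType;
  edge_weight : vertex -> vertex -> R;
  vmass : vertex -> R;
  vmass_gt0 : forall x, 0 < vmass x;
  edge_weight_ge0 : forall x y, 0 <= edge_weight x y;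
  edge_weightC : forall x y, edge_weight x y = edge_weight y x;
  edge_weightxx : forall x, edge_weight x x = 0
}.

Arguments edge_weight {R w} x y.
Arguments vmass {R w} x.

Section Graph.
Variables (R : realType) (G : wgraph R).
Implicit Types (x y : G) (r n : nat) (f : G -> R).

Definition mass (A : set G) : \bar R := (\esum_(x in A) (vmass x)%:E)%E.

Definition adjacent : rel G := fun x y => 0 < edge_weight x y.

Definition locally_finite : Prop :=
  forall x, finite_set [set y | adjacent x y].

(* [n] counts edges: the path is [x :: p]. *)
Definition joined x y n : Prop :=
  exists p : seq G, [/\ path adjacent x p, last x p = y & size p = n].

Definition connected_graph : Prop := forall x y, exists n, joined x y n.

Lemma joined_asbool x y :
  (exists n, joined x y n) -> exists n, `[< joined x y n >].
Proof. by case=> n xyn; exists n; apply/asboolP. Qed.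

(* Vertices in different components get the placeholder value 0; this case
   does not occur in a connected graph. *)
Definition dist x y : nat :=
  if pselect (exists n, joined x y n) is left xy
  then ex_minn (joined_asbool xy) else 0%N.

Definition sphere x0 r : set G := [set x | dist x x0 = r].

(* The sums over [_ \in _] are finite-support sums: in a locally finite graph
   [edge_weight x] has finite support and spheres are finite. *)
Definition outer_curvature x0 x : R :=
  (vmass x)^-1 * \sum_(y \in sphere x0 (dist x x0).+1) edge_weight x y.

Definition inner_curvature x0 x : R :=
  if x == x0 then 0 else
  (vmass x)^-1 * \sum_(y \in sphere x0 (dist x x0).-1) edge_weight x y.

Definition average x0 f x : R :=
  (fine (mass (sphere x0 (dist x x0))))^-1 *
  \sum_(y \in sphere x0 (dist x x0)) f y * vmass y.

End Graph.

Arguments locally_finite {R} G.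
Arguments connected_graph {R} G.

Definition stronger_average_curvature_growth (R : realType)
    (G1 G2 : wgraph R) (x1 : G1) (x2 : G2) : Prop :=
  vmass x1 = vmass x2 /\
  forall (r : nat) (x' : G1) (x'' : G2), sphere x1 r x' -> sphere x2 r x'' ->
    average x2 (outer_curvature x2) x'' <= average x1 (outer_curvature x1) x' /\
    average x1 (inner_curvature x1) x' <= average x2 (inner_curvature x2) x''.

Definition faster_volume_growth (R : realType)
    (G1 G2 : wgraph R) (x1 : G1) (x2 : G2) : Prop :=
  forall r : nat, (mass (sphere x2 r) <= mass (sphere x1 r))%E.

(* Main.v *)
Require Import Defs.
From mathcomp Require Import all_boot all_order all_algebra.
From mathcomp Require Import all_classical all_reals all_analysis.

(** Let F_r be the total edge weight between the spheres S_r and S_{r+1}.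
    Summing the curvatures over spheres and using the symmetry of b gives
      m(S_r) A k_+(r) = F_r = m(S_{r+1}) A k_-(r+1),
    so m(S_{r+1}) is m(S_r) multiplied by the ratio of the averaged outer
    curvature at r to the averaged inner curvature at r+1. The theorem follows
    by induction on r; when S_{r+1}(x_1) is empty the outer curvature of G_1 at
    r averages to 0, which forces S_{r+1}(x_2) to be empty as well. *)

Import Order.TTheory GRing.Theory Num.Theory.

Section Sphere.
Local Open Scope classical_set_scope.
Local Open Scope ring_scope.
Context {R : realType} {G : wgraph R}.
Hypotheses (conn : connected_graph G) (lf : locally_finite G).
Implicit Types (x y : G) (r n : nat).

(* MathComp-Analysis has an [adjacent] of its own, on sequences. *)
Local Notation adjacent := Defs.adjacent.

Lemma adjacent_sym x y : adjacent x y = adjacent y x.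
Proof. by rewrite /adjacent edge_weightC. Qed.

Lemma joined_dist x y : joined x y (dist x y).
Proof.
rewrite /dist; case: pselect => [xy|/(_ (conn x y))//].
by case: ex_minnP => n /asboolP.
Qed.

Lemma dist_le x y n : joined x y n -> (dist x y <= n)%N.
Proof.
move=> xyn; rewrite /dist; case: pselect => [xy|[]]; last by exists n.
by case: ex_minnP => k _; apply; apply/asboolP.
Qed.

Lemma distxx x : dist x x = 0%N.
Proof. by apply/eqP; rewrite -leqn0 dist_le//; exists [::]. Qed.

Lemma dist_eq0 x y : dist x y = 0%N -> x = y.
Proof.
by have := joined_dist x y; move=> + xy0; rewrite xy0 => -[p [_ <- /eqP/nilP->]].
Qed.

Lemma dist_adjacent_le x y z : adjacent x y -> (dist x z <= (dist y z).+1)%N.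
Proof.
move=> xy; have [p [pyz pz sp]] := joined_dist y z.
by apply: dist_le; exists (y :: p); split; rewrite /= ?xy ?sp.
Qed.

(** The witness is the second vertex of a shortest path: the tail bounds its distance by [r], and a
    smaller distance would bring [x] closer than [r.+1]. *)
Lemma dist_predecessor x x0 r :
  dist x x0 = r.+1 -> exists2 y, adjacent x y & dist y x0 = r.
Proof.
move=> xr; have [p []] := joined_dist x x0.
rewrite xr; case: p => //= y p /andP[xy yp] px0 [sp].
exists y => //; apply/eqP; rewrite eqn_leq; apply/andP; split.
  by apply: dist_le; exists p.
by have := dist_adjacent_le x y x0 xy; rewrite xr.
Qed.

Lemma sphere0 x0 : sphere x0 0 = [set x0].
Proof.
by apply/seteqP; split=> x /=; [exact: dist_eq0|move=> ->; exact: distxx].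
Qed.

Lemma sphereS_nonempty x0 r : sphere x0 r.+1 !=set0 -> sphere x0 r !=set0.
Proof. by move=> [x /dist_predecessor[y _ yr]]; exists y. Qed.

(** By predecessors, each sphere lies in the union of the neighborhoods of the previous one, a
    finite union of finite sets. *)
Lemma sphere_finite x0 r : finite_set (sphere x0 r).
Proof.
elim: r => [|r IH]; first by rewrite sphere0; exact: finite_set1.
apply: (@sub_finite_set _ _ (\bigcup_(y in sphere x0 r) [set x | adjacent y x])).
  by move=> x /dist_predecessor[y xy yr]; exists y => //=; rewrite adjacent_sym.
by apply: bigcup_finite => // y _; exact: lf.
Qed.

Lemma mass_finite (A : set G) :
  finite_set A -> mass A = (\sum_(x \in A) vmass x)%:E.
Proof.
move=> fA; rewrite /mass esum_fset ?fsumEFin// => x _.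
by rewrite lee_fin ltW// vmass_gt0.
Qed.

Lemma fine_mass_gt0 (A : set G) :
  finite_set A -> A !=set0 -> 0 < fine (mass A).
Proof.
move=> fA [x Ax]; rewrite mass_finite//= lt_neqAle.
have ge0 y : A y -> 0 <= vmass y by move=> _; rewrite ltW// vmass_gt0.
rewrite fsumr_ge0// andbT eq_sym; apply/eqP => /(pfsumr_eq0 fA ge0)/(_ _ Ax) x0.
by have := vmass_gt0 x; rewrite x0 ltxx.
Qed.

Definition flux x0 r : R :=
  \sum_(x \in sphere x0 r) \sum_(y \in sphere x0 r.+1) edge_weight x y.

Lemma flux_ge0 x0 r : 0 <= flux x0 r.
Proof.
by apply: fsumr_ge0 => x _; apply: fsumr_ge0 => y _; exact: edge_weight_ge0.
Qed.

(** The edge from a vertex to its predecessor is one of the nonnegative terms; a zero double sum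
    would make its weight vanish. *)
Lemma flux_gt0 x0 r : sphere x0 r.+1 !=set0 -> 0 < flux x0 r.
Proof.
move=> [x xr]; have [y xy yr] := dist_predecessor x x0 r xr.
rewrite lt_neqAle flux_ge0 andbT eq_sym; apply/eqP => F0.
have b_ge0 z u : sphere x0 r.+1 u -> 0 <= edge_weight z u.
  by move=> _; exact: edge_weight_ge0.
have by0 := pfsumr_eq0 (sphere_finite x0 r)
  (fun z _ => fsumr_ge0 (b_ge0 z)) F0 yr.
have byx0 := pfsumr_eq0 (sphere_finite x0 r.+1) (b_ge0 y) by0 xr.
by move: xy; rewrite adjacent_sym /adjacent byx0 ltxx.
Qed.

Lemma flux_empty x0 r : sphere x0 r.+1 = set0 -> flux x0 r = 0.
Proof. by move=> e; apply: fsbig1 => x _; rewrite e fsbig_set0. Qed.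

Lemma mass_average_outer x0 r x : sphere x0 r x ->
  fine (mass (sphere x0 r)) * average x0 (outer_curvature x0) x = flux x0 r.
Proof.
move=> xr; rewrite /average (xr : dist x x0 = r) mulrA divff ?mul1r; last first.
  by rewrite gt_eqF// fine_mass_gt0//; [exact: sphere_finite|exists x].
apply: eq_fsbigr => y /[!inE] yr.
rewrite /outer_curvature (yr : dist y x0 = r) mulrAC mulVf ?mul1r//.
by rewrite gt_eqF// vmass_gt0.
Qed.

Lemma mass_average_inner x0 r x : sphere x0 r.+1 x ->
  fine (mass (sphere x0 r.+1)) * average x0 (inner_curvature x0) x = flux x0 r.
Proof.
move=> xr; rewrite /average (xr : dist x x0 = r.+1) mulrA divff ?mul1r; last first.
  by rewrite gt_eqF// fine_mass_gt0//; [exact: sphere_finite|exists x].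
(* The inner curvature sums the same edges from their outer ends. *)
rewrite /flux exchange_fsbig; [|exact: sphere_finite..].
apply: eq_fsbigr => y /[!inE] yr.
(* The convention that the inner curvature is 0 at the root does not interfere on a sphere of
   positive radius. *)
have yx0 : y == x0 = false.
  by apply/eqP => yx0; move: yr; rewrite /sphere /= yx0 distxx.
rewrite /inner_curvature yx0 (yr : dist y x0 = r.+1) mulrAC mulVf ?mul1r/=.
  by apply: eq_fsbigr => z _; rewrite edge_weightC.
by rewrite gt_eqF// vmass_gt0.
Qed.

End Sphere.

Theorem theorem3p5 (R : realType) (G1 G2 : wgraph R) (x1 : G1) (x2 : G2)
    (conn1 : connected_graph G1) (conn2 : connected_graph G2)
    (lf1 : locally_finite G1) (lf2 : locally_finite G2)
    (growth : stronger_average_curvature_growth x1 x2) :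
  faster_volume_growth x1 x2.
Proof.
have [m12 k12] := growth.
have fin1 r := sphere_finite conn1 lf1 x1 r.
have fin2 r := sphere_finite conn2 lf2 x2 r.
elim=> [|r IH].
  by rewrite !sphere0// !mass_finite ?fsbig_set1 ?m12//; exact: finite_set1.
have [->|/set0P ne2] := eqVneq (sphere x2 r.+1) set0.
  rewrite [mass set0]esum_set0; apply: esum_ge0 => x _.
  by rewrite lee_fin ltW// vmass_gt0.
have M2gt0 := fine_mass_gt0 _ (fin2 r) (sphereS_nonempty conn2 x2 r ne2).
have M2Sgt0 := fine_mass_gt0 _ (fin2 r.+1) ne2.
have IHf : (fine (mass (sphere x2 r)) <= fine (mass (sphere x1 r)))%R.
  by move: IH; rewrite !mass_finite.
have ne1r : (sphere x1 r !=set0)%classic.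
  apply/set0P/eqP => e; move: (lt_le_trans M2gt0 IHf).
  by rewrite e [mass set0]esum_set0 ltxx.
have M1gt0 := fine_mass_gt0 _ (fin1 r) ne1r.
have [[y1 y1r] [y2 y2r]] := (ne1r, sphereS_nonempty conn2 x2 r ne2).
have [outer_le _] := k12 r y1 y2 y1r y2r.
have F1 := mass_average_outer conn1 lf1 x1 r y1 y1r.
have F2 := mass_average_outer conn2 lf2 x2 r y2 y2r.
have F2gt0 := flux_gt0 conn2 lf2 x2 r ne2.
have outer2_gt0 : (0 < average x2 (outer_curvature x2) y2)%R.
  by move: F2gt0; rewrite -F2 pmulr_rgt0.
(* Each flux is mass times averaged outer curvature; [IHf] and [outer_le] compare the factors. *)
have F21 : (flux x2 r <= flux x1 r)%R.
  by rewrite -F1 -F2 ler_pM// ltW.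
have ne1 : (sphere x1 r.+1 !=set0)%classic.
  by apply/set0P/eqP => /flux_empty F0; move: F21; rewrite F0 leNgt F2gt0.
have M1Sgt0 := fine_mass_gt0 _ (fin1 r.+1) ne1.
have [[z1 z1r] [z2 z2r]] := (ne1, ne2).
have [_ inner_le] := k12 r.+1 z1 z2 z1r z2r.
have E1 := mass_average_inner conn1 lf1 x1 r z1 z1r.
have E2 := mass_average_inner conn2 lf2 x2 r z2 z2r.
have inner1_gt0 : (0 < average x1 (inner_curvature x1) z1)%R.
  by have := flux_gt0 conn1 lf1 x1 r ne1; rewrite -E1 pmulr_rgt0.
suff: (fine (mass (sphere x2 r.+1)) <= fine (mass (sphere x1 r.+1)))%R.
  by rewrite !mass_finite.
(* After multiplying by the averaged inner curvature of [G1], the right side is [flux x1 r], and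
   [inner_le] bounds the left side by [flux x2 r]. *)
rewrite -(ler_pM2r inner1_gt0) E1 (le_trans _ F21)// -E2.
by rewrite ler_pM2l.
Qed.
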